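(* Let $a_1,\dots,a_n,b_1,\dots,b_n,c$ be real constants and let $u:\mathbb{R}^n\to\mathbb{R}$ be a smooth strictly convex radially symmetric solution of $$\det D^2u=\exp\left\{-\sum_{i=1}^n a_i\frac{\partial u}{\partial x_i}+\sum_{i=1}^n b_ix_i+c\right\}\qquad\text{on } \mathbb{R}^n .$$ Then $u$ must be a quadratic polynomial.
   Context: Radially symmetric means that $u(x)$ depends only on $|x|$. $D^2u$ denotes the Hessian matrix of $u$; strictly convex means that $D^2u$ is positive definite everywhere. *)

(* Defs.v *)
From HB Require Import structures.
From mathcomp Require Import all_boot all_order all_algebra.
From mathcomp Require Import all_classical all_reals all_analysis.
Set Implicit Arguments.
Unset Strict Implicit.
Unset Printing Implicit Defensive.
Import Order.TTheory GRing.Theory Num.Theory.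
Import numFieldNormedType.Exports.
Local Open Scope ring_scope.

Section Defs.
Context (R : realType) (n : nat).
Implicit Types (u : 'rV[R]_n -> R) (x : 'rV[R]_n).

(* The library norm `|x| on 'rV[R]_n is the sup norm, hence this definition. *)
Definition enorm x : R := Num.sqrt (\sum_(i < n) x ord0 i ^+ 2).

Definition radially_symmetric u : Prop :=
  forall x y, enorm x = enorm y -> u x = u y.

Definition partial (i : 'I_n) u : 'rV[R]_n -> R :=
  fun x => 'D_(delta_mx ord0 i) u x.

(* Class C^oo: since 'D_v is total, existence of every iterated partial
   derivative is required separately from its continuity. *)
Definition smooth u : Prop :=
  forall s : seq 'I_n,
    continuous (foldr partial u s) /\
    forall (i : 'I_n) x, derivable (foldr partial u s) x (delta_mx ord0 i).

Definition hessian u x : 'M[R]_n := \matrix_(i, j) partial i (partial j u) x.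

(* Symmetry is not part of this definition; for the Hessian of a smooth
   function it is automatic. *)
Definition posdefmx (A : 'M[R]_n) : Prop :=
  forall v : 'rV[R]_n, v != 0 -> 0 < (v *m A *m v^T) ord0 ord0.

Definition strictly_convex u : Prop := forall x, posdefmx (hessian u x).

(* With A symmetric, A != 0 says exactly that the degree is 2. *)
Definition quadratic_polynomial u : Prop :=
  exists (A : 'M[R]_n) (l : 'rV[R]_n) (k : R),
    [/\ A^T = A, A != 0 &
      forall x, u x = (x *m A *m x^T) ord0 ord0 + (x *m l^T) ord0 ord0 + k].

End Defs.

(* Main.v *)
(* Writing [u x = f |x|], the Hessian of [u] is even in [x], so the odd part of
   the exponent vanishes: [sum a_i D_i u = sum b_i x_i].  On the i-th axis this
   reads [a_i f'(t) = b_i t].  If some [a_i] is nonzero, [f'] is linear.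
   Otherwise [a = b = 0] and on an axis the equation becomes
   [f'' (f'/t)^(n-1) = e^c], that is [(f'^n)' = (e^c t^n)'], and [f'(0) = 0]
   gives [f'(t) = e^(c/n) t].  In both cases [f] is quadratic. *)
Require Import Defs.
From HB Require Import structures.
From mathcomp Require Import all_boot all_order all_algebra.
From mathcomp Require Import all_classical all_reals all_analysis.
From mathcomp Require Import ring lra.
Set Implicit Arguments.
Unset Strict Implicit.
Unset Printing Implicit Defensive.
Import Order.TTheory GRing.Theory Num.Theory.
Import numFieldNormedType.Exports.
Local Open Scope ring_scope.

(** * Directional derivatives and the squared norm along coordinate lines *)

(** The two difference quotients are the same function of [h]. This turns a directional derivative
    into a one-variable one, to which the chain rule applies. *)
Lemma is_derive_lineP (R : realType) (V : normedModType R) (f : V -> R)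
    (x v : V) (t df : R) :
  is_derive t 1 (fun s : R => f (s *: v + x)) df <->
  is_derive (t *: v + x) v f df.
Proof.
have E : (fun h : R => h^-1 *:
           (f ((h *: (1 : R) + t) *: v + x) - f (t *: v + x))) =
         (fun h : R => h^-1 *: (f (h *: v + (t *: v + x)) - f (t *: v + x))).
  by apply/funext => h; rewrite [h *: 1]mulr1 scalerDl addrA.
by split=> -[d e]; split; move: d e; rewrite /derivable /derive /= E.
Qed.

Lemma is_derive_line0 (R : realType) (V : normedModType R) (f : V -> R)
    (x v : V) (df : R) :
  is_derive (0 : R) 1 (fun s : R => f (s *: v + x)) df -> is_derive x v f df.
Proof. by move/is_derive_lineP; rewrite scale0r add0r. Qed.

(** Unlike the norm, this is a polynomial in the coordinates, so it can be differentiated at every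
    point; the square root is composed with it afterwards. *)
Definition sqnorm (R : realType) (n : nat) (x : 'rV[R]_n) : R :=
  \sum_(i < n) x ord0 i ^+ 2.

Lemma sqnorm_ge0 (R : realType) (n : nat) (x : 'rV[R]_n) : 0 <= sqnorm x.
Proof. by apply: sumr_ge0 => i _; exact: sqr_ge0. Qed.

Lemma sqnormN (R : realType) (n : nat) (x : 'rV[R]_n) : sqnorm (- x) = sqnorm x.
Proof. by apply: eq_bigr => i _; rewrite mxE sqrrN. Qed.

Lemma sqnorm_shift (R : realType) (n : nat) (x : 'rV[R]_n) (i : 'I_n) (s : R) :
  sqnorm (s *: delta_mx ord0 i + x) = sqnorm x + 2 * x ord0 i * s + s ^+ 2.
Proof.
rewrite /sqnorm (bigD1 i) //= [\sum_(i < n) _](bigD1 i) //= !mxE !eqxx /=.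
rewrite [X in _ + X](eq_bigr (fun j => x ord0 j ^+ 2)); last first.
  by move=> j ji; rewrite !mxE (negbTE ji) andbF mulr0 add0r.
rewrite mulr1; ring.
Qed.

Lemma sqnorm_axis (R : realType) (n : nat) (i : 'I_n) (s : R) :
  sqnorm (s *: delta_mx ord0 i) = s ^+ 2.
Proof.
rewrite -[_ *: _]addr0 sqnorm_shift mxE /sqnorm big1 ?mulr0 ?mul0r ?add0r//.
by move=> j _; rewrite mxE expr0n.
Qed.

Lemma is_derive_sqnorm_line (R : realType) (n : nat) (x : 'rV[R]_n)
    (i : 'I_n) :
  is_derive (0 : R) 1 (fun s : R => sqnorm (s *: delta_mx ord0 i + x))
    (2 * x ord0 i).
Proof.
rewrite (_ : (fun s => _) = fun s => sqnorm x + 2 * x ord0 i * s + s ^+ 2);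
  last by apply/funext => s; exact: sqnorm_shift.
have di := is_derive_id (0 : R) (1 : R).
apply: is_derive_eq (is_deriveD (is_deriveD (is_derive_cst (sqnorm x) _ _)
  (is_deriveZ (2 * x ord0 i) di)) (is_deriveX 2 di)) _.
by rewrite /GRing.scale/= !(expr1, mulr1, mulr0, add0r, addr0).
Qed.

Lemma near_sqnorm_line_gt0 (R : realType) (n : nat) (x : 'rV[R]_n)
    (i : 'I_n) : 0 < sqnorm x ->
  \forall s \near (0 : R), 0 < sqnorm (s *: delta_mx ord0 i + x).
Proof.
move=> x0; have d := is_derive_sqnorm_line x i.
have /derivable1_diffP/differentiable_continuous c :=
  @ex_derive _ _ _ _ _ _ _ d.
by apply: (cvgr_gt _ c); rewrite scale0r add0r.
Qed.

(** * First and second derivatives of a radial function away from the origin *)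

Section RadialDerivatives.
Context (R : realType) (n : nat) (u : 'rV[R]_n -> R) (f f1 f2 : R -> R).
Hypothesis uE : forall x, u x = f (Num.sqrt (sqnorm x)).
Hypothesis f_f1 : forall t : R, is_derive t 1 f (f1 t).
Hypothesis f1_f2 : forall t : R, is_derive t 1 f1 (f2 t).

(** This is [f'(r) / r] as a function of [s = r ^+ 2], the factor for which the gradient of [u] at
    [x] is [slope (sqnorm x)] times [x]. *)
Definition slope (s : R) : R := f1 (Num.sqrt s) / Num.sqrt s.

Lemma partial_radial (x : 'rV[R]_n) (i : 'I_n) : 0 < sqnorm x ->
  partial i u x = x ord0 i * slope (sqnorm x).
Proof.
move=> x0; apply: derive_val.
apply: is_derive_line0.
rewrite (_ : (fun s => _) = f \o (Num.sqrt \o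
  (fun s : R => sqnorm (s *: delta_mx ord0 i + x)))); last first.
  by apply/funext => s /=; rewrite uE.
have d := is_derive_sqnorm_line x i.
have x0' : 0 < sqnorm (0 *: delta_mx ord0 i + x) by rewrite scale0r add0r.
have d' := is_derive1_comp (is_derive1_sqrt x0') d.
apply: is_derive_eq (is_derive1_comp (f_f1 _) d') _ => /=.
rewrite scale0r add0r /slope; field.
by rewrite sqrtr_eq0 -ltNge.
Qed.

Lemma derivable_slope (s : R) : 0 < s -> derivable slope s 1.
Proof.
move=> s0.
have d := is_derive1_sqrt s0.
have d' := is_derive1_comp (f1_f2 (Num.sqrt s)) d.
have sn0 : Num.sqrt s != 0 by rewrite sqrtr_eq0 -ltNge.
apply: derivableM; first exact: ex_derive.
by apply: derivableV => //; exact: ex_derive.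
Qed.

(** Product rule for [x_j * slope (sqnorm x)]. The derivative of [slope] can stay implicit: later
    its coefficient either vanishes or is even in [x]. *)
Lemma hessian_radial (x : 'rV[R]_n) (i j : 'I_n) : 0 < sqnorm x ->
  hessian u x i j = (i == j)%:R * slope (sqnorm x)
    + 2 * x ord0 i * x ord0 j * 'D_1 slope (sqnorm x).
Proof.
move=> x0; rewrite mxE; apply: derive_val.
apply: is_derive_line0.
have d := is_derive_sqnorm_line x i.
have x0' : 0 < sqnorm (0 *: delta_mx ord0 i + x) by rewrite scale0r add0r.
have d' := is_derive1_comp (derivableP (derivable_slope x0')) d.
have e : is_derive (0 : R) 1
    (fun s : R => s * (i == j)%:R + x ord0 j) (i == j)%:R.
  apply: is_derive_eq.
  by rewrite /GRing.scale/= !(mulr1, mulr0, add0r, addr0).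
(* The closed form of the gradient holds only off the origin, so it replaces [partial j u] just for
   small [s], where the line has not reached 0. *)
apply: (@near_eq_is_derive R R R ((fun s : R => s * (i == j)%:R + x ord0 j) *
    (slope \o (fun s : R => sqnorm (s *: delta_mx ord0 i + x)))%FUN));
  last first.
  apply: is_derive_eq (is_deriveM e d') _.
  rewrite /= !scale0r !add0r mul0r add0r /GRing.scale /=; ring.
near=> s.
rewrite partial_radial; last by near: s; exact: near_sqnorm_line_gt0.
by rewrite /GRing.mul/= !mxE eqxx eq_sym.
Unshelve. all: by end_near. Qed.

End RadialDerivatives.

(** * One-variable calculus for the profile *)

Lemma constant_of_zero_derivative (R : realType) (h h1 : R -> R) (t : R) :
  (forall s : R, is_derive s 1 h (h1 s)) ->
  (forall s : R, 0 < s -> h1 s = 0) -> 0 <= t -> h t = h 0.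
Proof.
move=> dh h10; rewrite le_eqVlt => /predU1P[<-//|t0].
have [|s st] := @MVT R h h1 0 t t0 (fun s _ => dh s).
  apply: continuous_subspaceT => s.
  by apply/differentiable_continuous/derivable1_diffP; exact: ex_derive.
rewrite in_itv /= in st; case/andP: st => s0 _.
by rewrite h10// mul0r => /eqP; rewrite subr_eq0 => /eqP.
Qed.

(** Differentiating [f (- t) = f t] at 0 gives [- l = l]. *)
Lemma derivative_even_at0 (R : realType) (f : R -> R) (l : R) :
  is_derive (0 : R) 1 f l -> (forall t, f (- t) = f t) -> l = 0.
Proof.
move=> df fN.
have dN := is_deriveN (is_derive_id (0 : R) (1 : R)).
have df' : is_derive ((- id : R -> R) 0) 1 f l by rewrite /GRing.opp/= oppr0.
have := is_derive1_comp df' dN.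
rewrite (_ : _ \o _ = f); last by apply/funext => t; exact: fN.
move=> dl; have := derive_val (is_derive := dl).
rewrite (derive_val (is_derive := df)).
by rewrite mulrN1; lra.
Qed.

Lemma linear_derivative_quadratic (R : realType) (f f1 : R -> R) (lam t : R) :
  (forall s : R, is_derive s 1 f (f1 s)) ->
  (forall s : R, 0 < s -> f1 s = lam * s) ->
  0 <= t -> f t = lam / 2 * t ^+ 2 + f 0.
Proof.
move=> df f1E t0.
have dh (s : R) : is_derive s 1
    (fun s : R => f s - lam / 2 * s ^+ 2) (f1 s - lam * s).
  have d2 := is_deriveZ (lam / 2) (is_deriveX 2 (is_derive_id s (1 : R))).
  apply: is_derive_eq (is_deriveB (df s) d2) _.
  by rewrite /GRing.scale/= expr1 mulr1; field.
have := constant_of_zero_derivative dh _ t0; rewrite expr0n/= mulr0 subr0 => <-.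
  by rewrite addrC subrK.
by move=> s s0; rewrite f1E// subrr.
Qed.

Lemma increasing_from0_gt0 (R : realType) (g g1 : R -> R) (t : R) :
  (forall s : R, is_derive s 1 g (g1 s)) -> (forall s, 0 < g1 s) ->
  g 0 = 0 -> 0 < t -> 0 < g t.
Proof.
move=> dg g1_gt0 g0 t0.
have [|s st] := @MVT R g g1 0 t t0 (fun s _ => dg s).
  apply: continuous_subspaceT => s.
  by apply/differentiable_continuous/derivable1_diffP; exact: ex_derive.
by rewrite g0 !subr0 => ->; rewrite mulr_gt0.
Qed.

(** Up to the factor [n.+1], the equation says that [g ^+ n.+1] and [expR c * s ^+ n.+1] have the
    same derivative. Both vanish at 0, hence they agree, and roots can be taken because [g] is
    positive on the right of 0. Here [n] stands for the dimension minus one. *)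
Lemma power_ode_linear (R : realType) (n : nat) (c : R) (g g1 : R -> R) :
  (forall s : R, is_derive s 1 g (g1 s)) -> (forall s, 0 < g1 s) -> g 0 = 0 ->
  (forall s, 0 < s -> g1 s * g s ^+ n = expR c * s ^+ n) ->
  forall t, 0 < t -> g t = expR (c / n.+1%:R) * t.
Proof.
move=> dg g1_gt0 g0 ode t t0.
have dh (s : R) : is_derive s 1 (fun s : R => g s ^+ n.+1 - expR c * s ^+ n.+1)
    (n.+1%:R * (g1 s * g s ^+ n - expR c * s ^+ n)).
  have d1 := is_deriveX n.+1 (dg s).
  have d2 := is_deriveZ (expR c) (is_deriveX n.+1 (is_derive_id s (1 : R))).
  rewrite (_ : (fun s => _) = g ^+ n.+1 - expR c \*: (id ^+ n.+1)); last first.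
    by apply/funext => r; rewrite !fctE.
  by apply: is_derive_eq (is_deriveB d1 d2) _; rewrite /GRing.scale/=; ring.
have h0 (s : R) : 0 < s -> n.+1%:R * (g1 s * g s ^+ n - expR c * s ^+ n) = 0.
  by move=> s0; rewrite ode// subrr mulr0.
have := constant_of_zero_derivative dh h0 (ltW t0).
rewrite g0 !expr0n/= mulr0 subrr => /eqP; rewrite subr_eq0 => /eqP gE.
apply/eqP; rewrite -(@eqrXn2 _ n.+1)// ?mulr_ge0 ?expR_ge0 ?ltW//; last first.
  exact: increasing_from0_gt0 dg _ _ _.
by rewrite gE exprMn -expRM_natl [_ * (c / _)]mulrC divfK ?pnatr_eq0.
Qed.

Lemma slope_sqr (R : realType) (f1 : R -> R) (t : R) : 0 < t ->
  slope f1 (t ^+ 2) = f1 t / t.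
Proof. by move=> t0; rewrite /slope sqrtr_sqr gtr0_norm. Qed.

(** * The profile of a radial convex function and its Hessian on an axis *)

Section RadialSolution.
Context (R : realType) (n : nat) (u : 'rV[R]_n -> R) (k : 'I_n).
Hypothesis u_smooth : smooth u.
Hypothesis u_convex : strictly_convex u.
Hypothesis u_radial : radially_symmetric u.

Let e : 'rV[R]_n := delta_mx ord0 k.
(** The profile is taken on the whole [k]-th axis, negative [t] included, so that it is even and
    differentiable at 0. Its derivatives are read off from those of [u], so smoothness and convexity
    carry over directly. *)
Let f (t : R) : R := u (t *: e).
Let f1 (t : R) : R := partial k u (t *: e).
Let f2 (t : R) : R := hessian u (t *: e) k k.

Lemma radialE (x : 'rV[R]_n) : u x = f (Num.sqrt (sqnorm x)).
Proof.
apply: u_radial; rewrite -[RHS]/(Num.sqrt (sqnorm (Num.sqrt (sqnorm x) *: e))).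
by rewrite sqnorm_axis sqr_sqrtr ?sqnorm_ge0.
Qed.

Lemma is_derive_axis (w : 'rV[R]_n -> R) (t : R) :
  (forall x, derivable w x e) ->
  is_derive t 1 (fun s : R => w (s *: e)) (partial k w (t *: e)).
Proof.
move=> dw; rewrite (_ : (fun s => _) = fun s => w (s *: e + 0)); last first.
  by apply/funext => s; rewrite addr0.
by apply/is_derive_lineP; rewrite addr0; exact: derivableP.
Qed.

Lemma is_derive_profile (t : R) : is_derive t 1 f (f1 t).
Proof. by apply: is_derive_axis => x; exact: (u_smooth [::]).2. Qed.

Lemma is_derive_profile1 (t : R) : is_derive t 1 f1 (f2 t).
Proof.
rewrite /f2 mxE; apply: is_derive_axis => x; exact: (u_smooth [:: k]).2.
Qed.

Lemma profile2_gt0 (t : R) : 0 < f2 t.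
Proof.
have e0 : e != 0.
  apply/eqP => /matrixP/(_ ord0 k)/eqP; rewrite !mxE !eqxx/=.
  by rewrite oner_eq0.
(* The quadratic form of the Hessian at [e] is its diagonal entry at [k]. *)
have := u_convex (t *: e) e0.
by rewrite -rowE trmx_delta -colE /f2 !mxE.
Qed.

Lemma profile1_0 : f1 0 = 0.
Proof.
apply: derivative_even_at0 (is_derive_profile 0) _ => t.
apply: u_radial; rewrite -[LHS]/(Num.sqrt (sqnorm (- t *: e))).
by rewrite -[RHS]/(Num.sqrt (sqnorm (t *: e))) !sqnorm_axis sqrrN.
Qed.

(** On the axis the Hessian is diagonal: [f2 t] in the radial direction and [f1 t / t] in the [n.-1]
    orthogonal ones. *)
Lemma det_hessian_axis (t : R) : 0 < t ->
  \det (hessian u (t *: e)) = f2 t * (f1 t / t) ^+ n.-1.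
Proof.
move=> t0; have x0 : 0 < sqnorm (t *: e) by rewrite sqnorm_axis exprn_gt0.
have -> : hessian u (t *: e) =
    diag_mx (\row_i (if i == k then f2 t else f1 t / t)).
  apply/matrixP => i j; rewrite !mxE.
  case: (eqVneq i j) => [<-|ij]; last first.
    rewrite mulr0n.
    have := hessian_radial radialE is_derive_profile is_derive_profile1 i j x0.
    rewrite mxE => ->; rewrite (negbTE ij) mul0r add0r !mxE eqxx /=.
    case: (eqVneq i k) => [ik|_]; last by rewrite !(mulr0, mul0r).
    by rewrite -ik eq_sym (negbTE ij) !(mulr0, mul0r).
  (* The radial entry is [f2 t] by definition, so the derivative of [slope] need not be computed. *)
  rewrite mulr1n; case: (eqVneq i k) => [->|ik]; first by rewrite /f2 mxE.
  have := hessian_radial radialE is_derive_profile is_derive_profile1 i i x0.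
  rewrite mxE => ->; rewrite eqxx mul1r !mxE (negbTE ik) !(mulr0, mul0r) addr0.
  by rewrite sqnorm_axis slope_sqr.
rewrite det_diag (bigD1 k)//= mxE eqxx; congr (_ * _).
rewrite (eq_bigr (fun=> f1 t / t)); last first.
  by move=> i ik; rewrite mxE (negbTE ik).
by rewrite prodr_const cardC1 card_ord.
Qed.

(** In the closed form, [x] enters only through [sqnorm x] and the products [x_i * x_j], all
    even. *)
Lemma hessianN (x : 'rV[R]_n) : 0 < sqnorm x -> hessian u (- x) = hessian u x.
Proof.
move=> x0; have x0' : 0 < sqnorm (- x) by rewrite sqnormN.
apply/matrixP => i j.
have H := hessian_radial radialE is_derive_profile is_derive_profile1 i j.
by rewrite (H _ x0) (H _ x0') sqnormN !mxE !(mulrN, mulNr) opprK.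
Qed.

Lemma partial_axis (i : 'I_n) (t : R) : 0 < t ->
  partial i u (t *: delta_mx ord0 i) = f1 t.
Proof.
move=> t0; have x0 : 0 < sqnorm (t *: delta_mx ord0 i : 'rV[R]_n).
  by rewrite sqnorm_axis exprn_gt0.
rewrite (partial_radial radialE is_derive_profile)// sqnorm_axis slope_sqr//.
by rewrite !mxE !eqxx mulr1 mulrC divfK ?gt_eqF.
Qed.

Lemma partial_axis_off (i j : 'I_n) (t : R) : 0 < t -> j != i ->
  partial j u (t *: delta_mx ord0 i) = 0.
Proof.
move=> t0 ji; have x0 : 0 < sqnorm (t *: delta_mx ord0 i : 'rV[R]_n).
  by rewrite sqnorm_axis exprn_gt0.
rewrite (partial_radial radialE is_derive_profile)//.
by rewrite !mxE (negbTE ji) andbF mulr0 mul0r.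
Qed.

Lemma partialN (x : 'rV[R]_n) (i : 'I_n) : 0 < sqnorm x ->
  partial i u (- x) = - partial i u x.
Proof.
move=> x0; have x0' : 0 < sqnorm (- x) by rewrite sqnormN.
by rewrite !(partial_radial radialE is_derive_profile)// sqnormN mxE mulNr.
Qed.

Lemma quadratic_of_linear_profile (lam : R) :
  (forall t : R, 0 < t -> f1 t = lam * t) -> quadratic_polynomial u.
Proof.
move=> f1E.
(* [lam] is [f1 1], positive since [f1] vanishes at 0 and increases. This makes the quadratic part
   nonzero. *)
have lam0 : 0 < lam.
  rewrite -[lam]mulr1 -f1E//.
  exact: increasing_from0_gt0 is_derive_profile1 profile2_gt0 profile1_0 ltr01.
exists (lam / 2)%:M, 0, (f 0); split.
- by rewrite tr_scalar_mx.
- apply/eqP => /matrixP/(_ k k)/eqP; rewrite !mxE eqxx mulr1n.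
  by rewrite gt_eqF// divr_gt0.
- move=> x; rewrite trmx0 mulmx0 !mxE addr0 radialE.
  rewrite (linear_derivative_quadratic is_derive_profile f1E (sqrtr_ge0 _)).
  rewrite sqr_sqrtr ?sqnorm_ge0//; congr (_ + _).
  rewrite /sqnorm mulr_sumr; apply: eq_bigr => i _.
  by rewrite mul_mx_scalar !mxE expr2 mulrA.
Qed.

(** * Parity of the equation and the resulting linear [f1] *)

Context (a b : 'I_n -> R) (c : R).
Hypothesis u_eq : forall x : 'rV[R]_n,
  \det (hessian u x) =
  expR (- (\sum_(i < n) a i * partial i u x)
        + \sum_(i < n) b i * x ord0 i + c).

(** The determinants at [x] and [- x] agree, hence so do the exponents, while both sums change
    sign. *)
Lemma odd_terms_balance (x : 'rV[R]_n) : 0 < sqnorm x ->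
  \sum_(i < n) a i * partial i u x = \sum_(i < n) b i * x ord0 i.
Proof.
move=> x0.
have aN : \sum_(i < n) a i * partial i u (- x) =
    - \sum_(i < n) a i * partial i u x.
  by rewrite -sumrN; apply: eq_bigr => i _; rewrite partialN// mulrN.
have bN : \sum_(i < n) b i * (- x) ord0 i = - \sum_(i < n) b i * x ord0 i.
  by rewrite -sumrN; apply: eq_bigr => i _; rewrite mxE mulrN.
have := u_eq (- x); rewrite hessianN// u_eq aN bN => /expR_inj.
lra.
Qed.

(** On the [i]-th axis only the [i]-th term of each sum survives; by radial symmetry the profile is
    the same [f1] for every [i]. *)
Lemma coef_balance (i : 'I_n) (t : R) : 0 < t -> a i * f1 t = b i * t.
Proof.
move=> t0; have := @odd_terms_balance (t *: delta_mx ord0 i).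
rewrite sqnorm_axis exprn_gt0// => /(_ isT).
rewrite (bigD1 i)//= [in RHS](bigD1 i)//= partial_axis// !mxE !eqxx mulr1.
rewrite !big1 ?addr0// => j ji; last by rewrite partial_axis_off// mulr0.
by rewrite !mxE (negbTE ji) andbF !mulr0.
Qed.

Lemma radial_solution_quadratic : quadratic_polynomial u.
Proof.
have [/existsP[i ai0]|] := boolP [exists i, a i != 0].
  apply: (@quadratic_of_linear_profile (b i / a i)) => t t0.
  by apply: (mulfI ai0); rewrite coef_balance// mulrA mulrCA divff// mulr1.
rewrite negb_exists => /forallP a0.
have a_eq0 i : a i = 0 by apply/eqP; rewrite -[_ == _]negbK a0.
(* The balance at [t = 1], with [a i = 0]. *)
have b_eq0 i : b i = 0.
  by have := coef_balance i (@ltr01 R); rewrite a_eq0 mul0r mulr1.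
have n_gt0 : (0 < n)%N by exact: leq_ltn_trans (ltn_ord k).
(* [n.-1.+1] is the dimension, written to match the exponent [n.-1] of the tangential factor in the
   determinant. *)
apply: (@quadratic_of_linear_profile (expR (c / n.-1.+1%:R))).
apply: power_ode_linear is_derive_profile1 profile2_gt0 profile1_0 _ => t t0.
have := u_eq (t *: e); rewrite det_hessian_axis//.
rewrite big1 => [|i _]; last by rewrite a_eq0 mul0r.
rewrite big1 => [|i _]; last by rewrite b_eq0 mul0r.
rewrite oppr0 !add0r expr_div_n => <-.
by rewrite mulrA divfK// expf_neq0// gt_eqF.
Qed.

End RadialSolution.

Theorem theorem1p2 (R : realType) (n : nat) (n_gt0 : (0 < n)%N)
    (a b : 'I_n -> R) (c : R) (u : 'rV[R]_n -> R)
    (u_smooth : smooth u)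
    (u_convex : strictly_convex u)
    (u_radial : radially_symmetric u)
    (u_eq : forall x : 'rV[R]_n,
      \det (hessian u x) =
      expR (- (\sum_(i < n) a i * partial i u x)
            + \sum_(i < n) b i * x ord0 i + c)) :
  quadratic_polynomial u.
Proof.
exact: (radial_solution_quadratic
  (Ordinal n_gt0) u_smooth u_convex u_radial u_eq).
Qed.
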